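(* Let $\mathbb{F}$ be a field of characteristic different from $2$, let $n\geq 2$ and let $T$ be a strictly lower triangular $n\times n$ matrix with entries in $\mathbb{F}$. Then $T$ is equivalent by ETO's to a normalized matrix.
   Context: Let $\mathbb{F}$ be a field of characteristic different from $2$, and $\mathbb{F}^\times=\mathbb{F}\setminus\{0\}$. For $n\geq 2$, $\mathcal{TM}_n$ denotes the set of all strictly lower triangular $n\times n$ matrices with entries in $\mathbb{F}$, and $0_n$ the zero matrix. For $T=[t_{ij}]\in\mathcal{TM}_n$, $\mathcal{A}(T)$ is the commutative (unital, associative) $\mathbb{F}$-algebra given by generators $X_1,\dots,X_n$ and relations $X_1^2=0$ and $X_i^2=\sum_{j<i}t_{ij}X_jX_i$ for $2\leq i\leq n$; it is graded by $\deg(X_i)=2$. For $T,S\in\mathcal{TM}_n$ write $T\sim S$ if there is a degree preserving isomorphism of graded $\mathbb{F}$-algebras $\mathcal{A}(T)\to\mathcal{A}(S)$. Leaders: for $T\in\mathcal{TM}_n$ let $c_r=\max\{j:t_{rj}\neq 0\}$ if the $r$-th row is nonzero and $c_r=0$ otherwise; if $c_r>0$, $t_{r,c_r}$ is the leader and $(r,c_r)$ the leader position of row $r$. For $i<j<k$ put $\Delta^{(2)}_{i,j,k}(T)=2t_{ki}+t_{kj}t_{ji}$. 1-REF: $S\in\mathcal{TM}_n$, $S\neq 0_n$, is in first reduced echelon form (1-REF) if (1) its zero rows are above its nonzero rows; (2) for each leader position $(r,c)$ we have $c>1$ and there is $1\leq i_0<c$ with $\Delta^{(2)}_{i_0,c,r}(S)\neq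 0$; (3) $c_r\leq c_{r+1}$ whenever rows $r,r+1$ are both nonzero. The zero matrix is also in 1-REF. Wall: if $S\nsim 0_n$ is in 1-REF, put $r_1=\min\{r: \text{row } r \text{ of } S\text{ is nonzero}\}$ and, given $r_j$, let $A_j=\{r: r_j<r\leq n,\ c_r\geq r_j\}$; if $A_j\neq\emptyset$ put $r_{j+1}=\min A_j$, otherwise stop and set $\mathbb{W}(S)=(r_1,\dots,r_j)$. Set $\mathbb{W}(0_n)=(0)$. For arbitrary $T\in\mathcal{TM}_n$, $\mathbb{W}(T)=\mathbb{W}(S)$ for any $S$ in 1-REF with $T\sim S$ (it is known that such $S$ exists and that this is well defined). For a wall $(r_1,\dots,r_h)$ put $r_0=1$, $r_{h+1}=n+1$. 2-REF: $T\nsim 0_n$ with $\mathbb{W}(T)=(r_1,\dots,r_h)$ is in second reduced echelon form (2-REF) if (1) $T$ has exactly $r_1-1$ zero rows, and they are above the nonzero rows; (2) for each leader position $(r,c_r)$ we have $c_r>1$ and there is $1\leq i_0<c_r$ with $\Delta^{(2)}_{i_0,c_r,r}(T)\neq 0$; moreover for each $1\leq j\leq h$ and $r_j\leq r<r_{j+1}$ we have $r_{j-1}\leq c_r<r_j$; (3) for each $1\leq j\leq h$ and $r_j\leq r<r_{j+1}-1$, the number of nonzero entries of row $r$ in the columns $r_{j-1}\leq k<r_j$ is at most the number of nonzero entries of row $r+1$ in the same columns. The zero matrix is in 2-REF. Normalized: $U\nsim 0_n$ in 2-REF with $\mathbb{W}(U)=(r_1,\dots,r_h)$ is normalized if every nonzero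 entry of row $r_1$ equals $1$, and for each $r_1\leq r\leq n$ the leader of row $r$ equals $1$. The zero matrix is also normalized. Elementary triangular operations (ETO's) on $T=[t_{rk}]\in\mathcal{TM}_n$: (P) For $1\leq r_1\leq n$ and $\alpha\in\mathbb{F}^\times$, $\mathcal{P}_{r_1}(T,\alpha)=[s_{rk}]$ with $s_{rk}=\alpha^{-1}t_{rk}$ if $r=r_1$, $s_{rk}=\alpha t_{rk}$ if $k=r_1$, and $s_{rk}=t_{rk}$ otherwise. (F) For $1\leq r_1<r_2\leq n$, if $t_{r_2j}=0$ for all $j\geq r_1$ and $t_{rr_1}=0$ for all $r_1\leq r\leq r_2$, then $\mathcal{F}_{(r_1,r_2)}(T)$ is the matrix obtained from $T$ by simultaneously interchanging rows $r_1,r_2$ and columns $r_1,r_2$. (Q) Let $(r_0,k_0)$ be a leader position of $T$ and $\beta\in\mathbb{F}^\times$. If either $k_0=1$, or $k_0>1$ and $t_{r_0i}+t_{r_0k_0}t_{k_0i}=\beta t_{k_0i}$ for all $1\leq i<k_0$, then $\mathcal{Q}_{(r_0,k_0)}(T,\beta)=[s_{rk}]$ with $s_{r_0k_0}=t_{r_0k_0}-2\beta$, $s_{rk_0}=t_{rk_0}+\beta t_{rr_0}$ for $r>r_0$, and $s_{rk}=t_{rk}$ otherwise. $T$ and $S$ are equivalent by ETO's, written $T\approx S$, if they are related by the equivalence relation on $\mathcal{TM}_n$ generated by these operations, i.e. there is a finite sequence of matrices from $T$ to $S$ in which, for each consecutive pair, one is obtained from the other by an ETO (whenever well defined). *)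

(* Defs.v *)
From HB Require Import structures.
From mathcomp Require Import all_boot all_order all_algebra.
From mathcomp Require Import generic_quotient ring_quotient boolp mpoly.
From Stdlib Require Import Relation_Operators.

Set Implicit Arguments.
Unset Strict Implicit.
Unset Printing Implicit Defensive.

Import GRing.Theory.
Local Open Scope ring_scope.
Local Open Scope quotient_scope.

(* Indices are 0-based ordinals; leader columns ([lead]) and walls are 1-based
   natural numbers, so that 0 is free to mean "zero row" and "trivial wall". *)

Section StrictlyLowerTriangular.
Variables (F : fieldType) (n : nat).

Definition strictly_lower (A : 'M[F]_n) : bool :=
  [forall i : 'I_n, forall j : 'I_n, (i <= j)%N ==> (A i j == 0)].

Record TM := MkTM { tm_val :> 'M[F]_n; _ : strictly_lower tm_val }.

HB.instance Definition _ := [isSub for tm_val].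
HB.instance Definition _ := [Choice of TM by <:].

Lemma strictly_lower0 : strictly_lower 0.
Proof. by apply/forallP=> i; apply/forallP=> j; rewrite mxE eqxx implybT. Qed.

Definition tm0 : TM := MkTM strictly_lower0.

End StrictlyLowerTriangular.

Section Presentation.
Variables (F : fieldType) (n : nat) (T : TM F n).

Definition tm_rel (i : 'I_n) : {mpoly F[n]} :=
  'X_i ^+ 2 - \sum_(j < n | (j < i)%N) T i j *: ('X_j * 'X_i).

Definition tm_ideal : pred {mpoly F[n]} :=
  fun p => `[< exists q : 'I_n -> {mpoly F[n]}, p = \sum_i q i * tm_rel i >].

Lemma tm_relE0 i : (tm_rel i)@_0 = 0.
Proof.
have mX (j k : 'I_n) : ('X_j * 'X_k : {mpoly F[n]})@_0 = 0.
  by rewrite -mpolyXD mcoeffX -mdeg_eq0 mdegD !mdeg1.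
rewrite /tm_rel mcoeffB expr2 mX raddf_sum big1 ?subr0 // => j _.
by rewrite /= mcoeffZ mX mulr0.
Qed.

Lemma tm_ideal_closed : idealr_closed tm_ideal.
Proof.
split.
- by apply/asboolP; exists (fun=> 0); rewrite big1 // => i _; rewrite mul0r.
- apply/asboolP=> -[q /(congr1 (mcoeff 0))]; rewrite mcoeff1 eqxx raddf_sum.
  rewrite big1 => [/eqP|i _]; first by rewrite oner_eq0.
  by rewrite /= (rmorphM (mcoeff 0)) /= tm_relE0 mulr0.
- move=> a u v /asboolP[q ->] /asboolP[r ->]; apply/asboolP.
  exists (fun i => a * q i + r i); rewrite mulr_sumr -big_split /=.
  by apply: eq_bigr => i _; rewrite mulrDl mulrA.
Qed.

HB.instance Definition _ := isIdealr.Build {mpoly F[n]} tm_ideal tm_ideal_closed.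

Definition tm_alg : Type :=
  {ideal_quot (Idealr.clone {mpoly F[n]} tm_ideal _)}.

HB.instance Definition _ := GRing.ComNzRing.on tm_alg.
HB.instance Definition _ := EqQuotient.on tm_alg.

Definition tm_pi (p : {mpoly F[n]}) : tm_alg := \pi_tm_alg p.

Definition tm_scale (c : F) (x : tm_alg) : tm_alg := tm_pi c%:MP * x.

Lemma tm_pi_monoid : monoid_morphism tm_pi.
Proof. exact: pi_is_monoid_morphism. Qed.

Lemma tm_pi_zmod : zmod_morphism tm_pi.
Proof. exact: pi_is_zmod_morphism. Qed.

HB.instance Definition _ := GRing.isZmodMorphism.Build _ _ tm_pi tm_pi_zmod.
HB.instance Definition _ := GRing.isMonoidMorphism.Build _ _ tm_pi tm_pi_monoid.

Fact tm_scaleA a b x : tm_scale a (tm_scale b x) = tm_scale (a * b) x.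
Proof. by rewrite /tm_scale mpolyCM rmorphM mulrA. Qed.

Fact tm_scale1 : left_id 1 tm_scale.
Proof. by move=> x; rewrite /tm_scale mpolyC1 rmorph1 mul1r. Qed.

Fact tm_scaleDr : right_distributive tm_scale +%R.
Proof. by move=> c x y; rewrite /tm_scale mulrDr. Qed.

Fact tm_scaleDl x : {morph tm_scale^~ x : a b / a + b}.
Proof. by move=> a b; rewrite /tm_scale mpolyCD rmorphD mulrDl. Qed.

HB.instance Definition _ := GRing.Zmodule_isLmodule.Build F tm_alg
  tm_scaleA tm_scale1 tm_scaleDr tm_scaleDl.

Fact tm_scaleAl (c : F) (x y : tm_alg) : c *: (x * y) = (c *: x) * y.
Proof. exact: mulrA. Qed.

HB.instance Definition _ := GRing.Lmodule_isLalgebra.Build F tm_alg tm_scaleAl.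
HB.instance Definition _ := GRing.Lalgebra_isComAlgebra.Build F tm_alg.

(* [x] lies in the graded component of degree [k], each generator having
   degree 2; in particular the odd components are zero. *)
Definition tm_homog (k : nat) (x : tm_alg) : Prop :=
  exists2 p : {mpoly F[n]},
    x = tm_pi p & forall m, m \in msupp p -> (2 * mdeg m)%N = k.

End Presentation.

Section Isomorphism.
Variables (F : fieldType) (n : nat).

Definition tm_sim (T S : TM F n) : Prop :=
  exists2 f : {lrmorphism tm_alg T -> tm_alg S},
    bijective f & forall k x, tm_homog k x -> tm_homog k (f x).

End Isomorphism.

Section EchelonForms.
Variables (F : fieldType) (n : nat).
Implicit Types (T S U : TM F n) (r s c : 'I_n) (w : seq nat).

Definition zero_row T r : bool := row r T == 0.

Definition lead T r : nat := \max_(j < n | T r j != 0) j.+1.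

Definition leader_pos T r c : Prop := lead T r = c.+1.

Definition Delta2 T (i j k : 'I_n) : F := 2%:R * T k i + T k j * T j i.

Definition leader_cond T : Prop :=
  forall r c, leader_pos T r c ->
    (0 < c)%N /\ exists2 i : 'I_n, (i < c)%N & Delta2 T i c r != 0.

Definition zero_rows_above T : Prop :=
  forall r s, zero_row T r -> ~~ zero_row T s -> (r < s)%N.

Definition one_ref S : Prop :=
  S = tm0 F n \/
  [/\ zero_rows_above S, leader_cond S &
      forall r s, s = r.+1 :> nat -> ~~ zero_row S r -> ~~ zero_row S s ->
        (lead S r <= lead S s)%N].

Definition wall_next S r : {set 'I_n} :=
  [set s : 'I_n | (r < s)%N && (r.+1 <= lead S s)%N].

Definition is_min (A : {set 'I_n}) r : Prop :=
  r \in A /\ forall s, s \in A -> (r <= s)%N.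

Inductive wall_from S : 'I_n -> seq nat -> Prop :=
| WallStop r : wall_next S r = set0 -> wall_from S r [:: r.+1]
| WallStep r s w : is_min (wall_next S r) s -> wall_from S s w ->
    wall_from S r (r.+1 :: w).

Definition one_ref_wall S w : Prop :=
  S = tm0 F n /\ w = [:: 0%N] \/
  ~ tm_sim S (tm0 F n) /\
    exists2 r, is_min [set s | ~~ zero_row S s] r & wall_from S r w.

(* A relation rather than a function: the wall of T is known not to depend on
   the chosen 1-REF representative S. *)
Definition is_wall T w : Prop :=
  exists S, [/\ one_ref S, tm_sim T S & one_ref_wall S w].

(* [wall_bound w j] is r_j for a wall w = (r_1, ..., r_h), including the
   conventions r_0 = 1 and r_(h+1) = n+1. *)
Definition wall_bound w j : nat := nth 0%N (1%N :: rcons w n.+1) j.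

Definition row_weight T w j r : nat :=
  #|[set k : 'I_n | (wall_bound w j.-1 <= k.+1 < wall_bound w j)%N
                    && (T r k != 0)]|.

Definition two_ref_wrt w T : Prop :=
  [/\ #|[set r | zero_row T r]| = (wall_bound w 1).-1 /\ zero_rows_above T,
      leader_cond T /\
        forall (j : nat) r, (1 <= j <= size w)%N ->
          (wall_bound w j <= r.+1 < wall_bound w j.+1)%N ->
          (wall_bound w j.-1 <= lead T r < wall_bound w j)%N
    & forall (j : nat) r s, (1 <= j <= size w)%N -> s = r.+1 :> nat ->
        (wall_bound w j <= r.+1 < (wall_bound w j.+1).-1)%N ->
        (row_weight T w j r <= row_weight T w j s)%N].

Definition two_ref T : Prop :=
  T = tm0 F n \/
  ~ tm_sim T (tm0 F n) /\ exists2 w, is_wall T w & two_ref_wrt w T.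

Definition normalized U : Prop :=
  U = tm0 F n \/
  [/\ ~ tm_sim U (tm0 F n), two_ref U &
      exists2 w, is_wall U w &
        (forall r c, r.+1 = wall_bound w 1 -> U r c != 0 -> U r c = 1) /\
        (forall r c, (wall_bound w 1 <= r.+1)%N -> leader_pos U r c ->
           U r c = 1)].

End EchelonForms.

Section ElementaryTriangularOperations.
Variables (F : fieldType) (n : nat).
Implicit Types (T S : TM F n) (A : 'M[F]_n).

Definition etoP (r1 : 'I_n) (a : F) A : 'M[F]_n :=
  \matrix_(r, k) (if r == r1 then a^-1 * A r k
                  else if k == r1 then a * A r k else A r k).

Definition etoF_dom (r1 r2 : 'I_n) A : Prop :=
  [/\ (r1 < r2)%N, forall j : 'I_n, (r1 <= j)%N -> A r2 j = 0
    & forall r : 'I_n, (r1 <= r <= r2)%N -> A r r1 = 0].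

Definition etoF (r1 r2 : 'I_n) A : 'M[F]_n := xrow r1 r2 (xcol r1 r2 A).

Definition etoQ_dom (r0 k0 : 'I_n) (b : F) T : Prop :=
  leader_pos T r0 k0 /\
  (k0 = 0%N :> nat \/
   (0 < k0)%N /\ forall i : 'I_n, (i < k0)%N ->
     T r0 i + T r0 k0 * T k0 i = b * T k0 i).

Definition etoQ (r0 k0 : 'I_n) (b : F) A : 'M[F]_n :=
  \matrix_(r, k) (if (r == r0) && (k == k0) then A r k - 2%:R * b
                  else if (k == k0) && (r0 < r)%N then A r k + b * A r r0
                  else A r k).

Inductive eto T S : Prop :=
| EtoP r1 (a : F) of a != 0 & tm_val S = etoP r1 a T
| EtoF r1 r2 of etoF_dom r1 r2 T & tm_val S = etoF r1 r2 T
| EtoQ r0 k0 (b : F) of b != 0 & etoQ_dom r0 k0 b T & tm_val S = etoQ r0 k0 b T.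

Definition eto_equiv : TM F n -> TM F n -> Prop := clos_refl_sym_trans _ eto.

End ElementaryTriangularOperations.

(* Main.v *)
(* Bring T to 1-REF by lexicographic descent on the sequence of its leader
   columns: if the leader t of row r violates the discriminant condition, then Q
   with beta = t / 2 deletes it without touching the rows above r, and F exchanges
   two consecutive rows whose leader columns are in the wrong order. The wall of
   the resulting S cuts {1, ..., n} into consecutive blocks such that each row of a
   nonzero block has its nonzero entries in earlier blocks and its leader in the
   block just before. Hence F exchanges any two indices of the same block, which
   sorts the rows of each block by weight, and P rescales the leaders from the top
   row downwards. The result U is a monomial conjugate of S, so its algebra is
   isomorphic to that of S, and S witnesses the wall of U.

   A nonzero matrix T satisfying the leader condition has T not ~ 0: an element
   with linear part sum_i a_i X_i and square zero satisfies
   a_i (2 a_j + t_ij a_i) = 0 for j < i, and if a_r <> 0 in a nonzero row r with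
   leader column c, then a_c <> 0 and all Delta_{i,c,r} vanish. So such linear
   parts cannot span, as they do for the zero matrix. *)
Require Import Defs.
From mathcomp Require Import all_boot all_algebra.
From HB Require Import structures.
From mathcomp Require Import order perm boolp mpoly.
From mathcomp Require Import ring.
From Stdlib Require Import Relation_Operators.

Set Implicit Arguments.
Unset Strict Implicit.
Unset Printing Implicit Defensive.

Import GRing.Theory.
Local Open Scope ring_scope.

(** * Second-order Taylor coefficients of elements of the ideal of relations *)

Section SecondOrderJets.
Variables (F : fieldType) (n : nat).
Implicit Types (T : TM F n) (p q : {mpoly F[n]}) (i j k : 'I_n).

Lemma TM_upper0 T i j : (i <= j)%N -> T i j = 0.
Proof.
by case: T => A /= /forallP/(_ i)/forallP/(_ j)/implyP low ij; apply/eqP/low.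
Qed.

Lemma TM_lt T i j : T i j != 0 -> (j < i)%N.
Proof. by rewrite ltnNge; apply: contraNN => /TM_upper0 ->. Qed.

(* Taylor coefficients at 0; [jet2 i i] is twice the coefficient of ['X_i ^+ 2]. *)
Definition jet1 i p : F := (p^`M(i))@_0.
Definition jet2 i j p : F := (p^`M(i)^`M(j))@_0.

Lemma mderivXU i j : ('X_j : {mpoly F[n]})^`M(i) = (j == i)%:R%:MP.
Proof.
rewrite mderivX mnm1E; case: eqP => [->|_]; last by rewrite scale0r mpolyC0.
by rewrite -{1}(add0m U_(i)%MM) addmK mpolyX0 scale1r mpolyC1.
Qed.

Lemma coef0M p q : (p * q)@_0 = p@_0 * q@_0.
Proof. exact: (rmorphM (mcoeff 0)). Qed.

Lemma coef0XU i : ('X_i : {mpoly F[n]})@_0 = 0.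
Proof. by rewrite mcoeffX -mdeg_eq0 mdeg1. Qed.

Lemma jet1M i p q : jet1 i (p * q) = jet1 i p * q@_0 + p@_0 * jet1 i q.
Proof. by rewrite /jet1 mderivM mcoeffD !coef0M. Qed.

Lemma jet2M i j p q : jet2 i j (p * q) =
  jet2 i j p * q@_0 + jet1 i p * jet1 j q + jet1 j p * jet1 i q + p@_0 * jet2 i j q.
Proof. by rewrite /jet2 /jet1 mderivM mderivD !mderivM !mcoeffD !coef0M addrA. Qed.

Lemma jet1XU i j : jet1 i 'X_j = (j == i)%:R.
Proof. by rewrite /jet1 mderivXU mcoeffC eqxx mulr1. Qed.

Lemma jet2XU i j k : jet2 i j 'X_k = 0.
Proof. by rewrite /jet2 mderivXU mderivC mcoeff0. Qed.

HB.instance Definition _ i := GRing.isZmodMorphism.Build {mpoly F[n]} F (jet1 i)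
  (fun p q => etrans (congr1 (mcoeff 0) (mderivB i p q)) (mcoeffB _ _ _)).

Fact jet2_is_zmod_morphism i j : zmod_morphism (jet2 i j).
Proof. by move=> p q; rewrite /jet2 !mderivB mcoeffB. Qed.
HB.instance Definition _ i j :=
  GRing.isZmodMorphism.Build {mpoly F[n]} F (jet2 i j) (jet2_is_zmod_morphism i j).

Lemma jet1Z i c p : jet1 i (c *: p) = c * jet1 i p.
Proof. by rewrite /jet1 mderivZ mcoeffZ. Qed.

Lemma jet2Z i j c p : jet2 i j (c *: p) = c * jet2 i j p.
Proof. by rewrite /jet2 !mderivZ mcoeffZ. Qed.

Lemma jet1_rel T i k : jet1 i (tm_rel T k) = 0.
Proof.
rewrite raddfB raddf_sum /= expr2 jet1M !coef0XU mulr0 mul0r addr0.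
rewrite big1 ?subr0 // => j _.
by rewrite jet1Z jet1M !coef0XU mulr0 mul0r addr0 mulr0.
Qed.

Lemma jet2_rel T i j k : (j <= i)%N ->
  jet2 i j (tm_rel T k) = 2%:R * (k == i)%:R * (k == j)%:R - (k == i)%:R * T i j.
Proof.
move=> leji.
rewrite raddfB raddf_sum /= expr2 jet2M !coef0XU !jet1XU !jet2XU.
rewrite !(mulr0, mul0r, add0r, addr0); congr (_ - _).
  by move: ((k == i)%:R : F) ((k == j)%:R : F) => a b; ring.
under eq_bigr => l _ do rewrite jet2Z jet2M !coef0XU !jet1XU !jet2XU
  !(mulr0, mul0r, add0r, addr0).
have [->|neki] := eqVneq k i.
  rewrite mul1r; case: (ltngtP j i) leji => // [ltji _|eqji _].
    rewrite (bigD1 j) //= eqxx !mulr1 big1 => [|l /andP[lti nej]].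
      rewrite (_ : i == j = false) /=; first by ring.
      by apply/eqP=> eij; rewrite eij ltnn in ltji.
    rewrite (negbTE nej) (_ : l == i = false) ?mul0r ?add0r ?mulr0 //.
    by apply/eqP=> e; rewrite e ltnn in lti.
  rewrite TM_upper0 ?eqji // big1 // => l lti.
  have nel : l == i = false by apply/eqP=> e; rewrite e ltnn in lti.
  by rewrite (ord_inj eqji) nel /=; ring.
(* With [k != i] a term contributes only if [k = j] and [l = i], against [l < k] and [j <= i]. *)
rewrite mul0r big1 // => l ltk.
have [ek|_] := eqVneq k j; last by rewrite /=; ring.
rewrite (_ : l == i = false) /=; first by ring.
by apply/eqP=> e; move: leji; rewrite -e -ek leqNgt ltk.
Qed.

(** The relations have no constant or linear part, so only the constant term of [q k] matters at
    second order in [q k * tm_rel T k]. For [k = i] the two jets of the relation are [- T i j] and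
    [2], which cancel in the combination; for [k != i] both vanish. *)
Lemma tm_ideal_jet T p : p \in tm_ideal T ->
  [/\ p@_0 = 0, forall i, jet1 i p = 0
    & forall i j, (j < i)%N -> 2%:R * jet2 i j p + T i j * jet2 i i p = 0].
Proof.
case/asboolP=> q ->; split=> [|i|i j ltji].
- by rewrite raddf_sum big1 //= => i _; rewrite coef0M tm_relE0 mulr0.
- rewrite raddf_sum big1 //= => k _.
  by rewrite jet1M tm_relE0 jet1_rel mulr0 mulr0 addr0.
rewrite !raddf_sum /= !mulr_sumr -big_split big1 //= => k _.
rewrite !jet2M !tm_relE0 !jet1_rel !mulr0 !add0r !jet2_rel // ?(ltnW ltji) //.
rewrite (TM_upper0 T (leqnn i)).
have [->|_] := eqVneq k i; last by rewrite !(mulr0, mul0r, subr0, addr0).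
rewrite (_ : i == j = false); last by apply/eqP=> e; rewrite e ltnn in ltji.
by rewrite /=; ring.
Qed.

Lemma tm_pi_eq T p q : tm_pi T p = tm_pi T q -> p - q \in tm_ideal T.
Proof. by move/eqP; rewrite -Quotient.idealrBE. Qed.

End SecondOrderJets.

(** * Leader columns and zero rows *)

Section Leaders.
Variables (F : fieldType) (n : nat).
Implicit Types (T : TM F n) (r c k : 'I_n).

Lemma lead_geS T r k : T r k != 0 -> (k < lead T r)%N.
Proof. by move=> Trk; rewrite /lead (bigmax_sup k). Qed.

Lemma lead_le T r : (lead T r <= r)%N.
Proof. by apply/bigmax_leqP=> k; apply: TM_lt. Qed.

Lemma lead_eq0 T r : lead T r = 0%N <-> forall k, T r k = 0.
Proof.
split=> [l0 k|T0].
  by apply/eqP; apply: contraT => /lead_geS; rewrite l0.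
by rewrite /lead big1 // => k; rewrite T0 eqxx.
Qed.

Lemma lead_gt0 T r : (0 < lead T r)%N -> exists2 c, T r c != 0 & lead T r = c.+1.
Proof.
case: (pickP [pred k | T r k != 0]) => [k Trk _|T0].
  have nz : (0 < #|[pred k | T r k != 0%R]|)%N by apply/card_gt0P; exists k.
  have [c Trc maxc] := eq_bigmax_cond (fun k : 'I_n => k.+1) nz.
  by exists c => //; rewrite -maxc; apply: eq_bigl.
rewrite lt0n => /eqP[]; apply/lead_eq0 => k.
by have := T0 k; rewrite inE => /negbFE/eqP.
Qed.

Lemma leader_posP T r c :
  leader_pos T r c <-> T r c != 0 /\ forall k, T r k != 0 -> (k <= c)%N.
Proof.
split=> [lrc|[Trc cmax]]; last first.
  by apply/eqP; rewrite eqn_leq lead_geS // andbT; apply/bigmax_leqP.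
have [|d Trd] := @lead_gt0 T r; rewrite lrc // => -[/ord_inj ecd].
by subst d; split=> // k /lead_geS; rewrite lrc.
Qed.

Lemma zero_rowE T r : zero_row T r = (lead T r == 0%N).
Proof.
apply/eqP/eqP=> [T0|/lead_eq0 T0]; last by apply/rowP=> k; rewrite !mxE.
by apply/lead_eq0=> k; move/rowP/(_ k): T0; rewrite !mxE.
Qed.

Lemma TM0P T : T = tm0 F n <-> forall r k, T r k = 0.
Proof.
split=> [-> r k|T0]; first by rewrite mxE.
by apply/val_inj/matrixP=> r k; rewrite T0 mxE.
Qed.

End Leaders.

(** * Square-zero elements and the algebra of the zero matrix *)

Section TrivialAlgebra.
Variables (F : fieldType) (n : nat).
Implicit Types (T : TM F n) (p : {mpoly F[n]}) (i j : 'I_n).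

Lemma tm_piZ T c p : tm_pi T (c *: p) = c *: tm_pi T p.
Proof. by rewrite -mul_mpolyC rmorphM. Qed.

Lemma tm_pi_eq0 T p : (tm_pi T p = 0) <-> p \in tm_ideal T.
Proof.
split=> [p0|]; first by rewrite -[p]subr0; apply: tm_pi_eq; rewrite p0 rmorph0.
rewrite -{1}[p]subr0 Quotient.idealrBE => /eqP p0.
by rewrite -(rmorph0 (tm_pi T)).
Qed.

Lemma linear_mpolyE p : (forall m, m \in msupp p -> mdeg m = 1%N) ->
  p = \sum_i p@_U_(i) *: 'X_i.
Proof.
move=> lin; apply/mpolyP=> m; rewrite raddf_sum /=.
under eq_bigr => i _ do rewrite mcoeffZ mcoeffX.
have [|mp] := boolP (m \in msupp p).
  move/lin/eqP; rewrite mdeg_eq1 => /existsP[i /eqP->].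
  rewrite (bigD1 i) //= eqxx mulr1 big1 ?addr0 // => j /negbTE ji.
  by rewrite eq_mnm1 ji mulr0.
rewrite (memN_msupp_eq0 mp) big1 // => i _.
by have [->|_] := eqVneq; rewrite ?mulr0 // (memN_msupp_eq0 mp) mul0r.
Qed.

(** Let [a] be the linear part of [p], whose constant term must vanish. Membership of [p * p] in the
    ideal then gives [2 * a i * (2 * a j + T i j * a i) = 0], where [2] and [a i] can be
    cancelled. *)
Lemma square0_jet T p i j : 2%:R != 0 :> F -> tm_pi T p * tm_pi T p = 0 ->
  (j < i)%N -> jet1 i p != 0 -> 2%:R * jet1 j p = - (T i j * jet1 i p).
Proof.
move=> n2 /eqP; rewrite -rmorphM => /eqP/tm_pi_eq0/tm_ideal_jet[+ _ +] ltji ai.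
rewrite coef0M => /eqP; rewrite mulf_eq0 orbb => /eqP p0 /(_ _ _ ltji).
rewrite !jet2M p0 !mul0r !mulr0 => e.
apply/eqP; rewrite -addr_eq0; apply/eqP/(mulfI ai)/(mulfI n2).
rewrite !mulr0 -{}[RHS]e.
by ring.
Qed.

(* An isomorphism with the algebra of the zero matrix provides square-zero
   elements whose linear parts span all linear forms. *)
Lemma tm_sim0_eq0 T : 2%:R != 0 :> F ->
  leader_cond T -> tm_sim T (tm0 F n) -> T = tm0 F n.
Proof.
move=> n2 lcT [f [g fK gK] fhom]; apply/TM0P=> r; apply/lead_eq0/eqP.
rewrite -leqn0 leqNgt; apply/negP=> /lead_gt0[c Trc /lcT[_ [i ltic]]].
have ltcr := TM_lt Trc.
(* [p k] lifts the preimage of the generator [X_k], whose square is zero on the trivial side. *)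
have [p gp] : exists p : 'I_n -> {mpoly F[n]},
    forall k, f (tm_pi T (p k)) = tm_pi (tm0 F n) 'X_k.
  exists (fun k => repr (g (tm_pi (tm0 F n) 'X_k))) => k.
  by rewrite /tm_pi reprK gK.
have p2 k : tm_pi T (p k) * tm_pi T (p k) = 0.
  apply: (can_inj fK); rewrite rmorphM rmorph0 /= gp -rmorphM; apply/tm_pi_eq0.
  apply/asboolP; exists (fun l => (l == k)%:R).
  rewrite (bigD1 k) //= eqxx mul1r big1 => [|l /negbTE->]; last by rewrite mul0r.
  rewrite /tm_rel big1 ?subr0 ?addr0 ?expr2 // => l _.
  by rewrite mxE scale0r.
(* Degree preservation makes the image of [X_r] a linear form [P], so [X_r] is a combination of the
   [p k] modulo the ideal, and some [p k] must involve [X_r]. *)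
have [|P fX linP] := fhom 2 (tm_pi T 'X_r).
  exists 'X_r => // m; rewrite msuppX inE => /eqP->.
  by rewrite mdeg1.
have {}linP m : m \in msupp P -> mdeg m = 1%N.
  by move/linP=> e; apply/eqP; rewrite -(eqn_pmul2l (ltn0Sn 1)) e.
have : tm_pi T 'X_r = tm_pi T (\sum_k P@_U_(k) *: p k).
  apply: (can_inj fK); rewrite fX {1}(linear_mpolyE linP) !rmorph_sum.
  by apply: eq_bigr => k _; rewrite /= !tm_piZ linearZ /= gp.
move/tm_pi_eq/tm_ideal_jet=> [_ /(_ r) + _].
rewrite raddfB raddf_sum /= jet1XU eqxx => /eqP; rewrite subr_eq0 => /eqP Xr.
have [k ak] : exists k, jet1 r (p k) != 0.
  apply/existsP; apply: contraT => /existsPn a0.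
  move/eqP: Xr; rewrite big1 ?oner_eq0 // => k _.
  by rewrite jet1Z (eqP (negbNE (a0 k))) mulr0.
have eqc := square0_jet n2 (p2 k) ltcr ak.
have akc : jet1 c (p k) != 0.
  apply/eqP=> c0; move/eqP: eqc.
  by rewrite c0 mulr0 eq_sym oppr_eq0 mulf_eq0 (negbTE Trc) (negbTE ak).
have eqi := square0_jet n2 (p2 k) ltic akc.
have eqri := square0_jet n2 (p2 k) (ltn_trans ltic ltcr) ak.
(* With [a] the linear part of [p k], the equations for [(r, c)], [(c, i)] and [(r, i)] combine to
   [a r * Delta2 T i c r = 0]. *)
case/eqP; apply: (mulfI ak); rewrite mulr0 /Delta2.
have -> : jet1 r (p k) * (2%:R * T r i + T r c * T c i) =
   2%:R * (T r i * jet1 r (p k)) + T c i * (T r c * jet1 r (p k)) by ring.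
rewrite -[T r i * _]opprK -eqri -[T r c * _]opprK -eqc.
have -> : 2%:R * - (2%:R * jet1 i (p k)) + T c i * - (2%:R * jet1 c (p k)) =
  - 2%:R * (2%:R * jet1 i (p k) + T c i * jet1 c (p k)) by ring.
by rewrite eqi addNr mulr0.
Qed.

End TrivialAlgebra.

(** * Isomorphisms induced by monomial substitutions of the generators *)

Section MonomialIsomorphism.
Variables (F : fieldType) (n : nat).
Implicit Types (T U : TM F n) (p : {mpoly F[n]}) (i j : 'I_n) (s : {perm 'I_n})
  (e : 'I_n -> F).

Lemma tm_rel_mem T i : tm_rel T i \in tm_ideal T.
Proof.
apply/asboolP; exists (fun j => (j == i)%:R).
by rewrite (bigD1 i) //= eqxx mul1r big1 ?addr0 // => j /negbTE->; rewrite mul0r.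
Qed.

(** The full sum can be reindexed by a permutation, whereas the range [j < i] need not be stable
    under one. *)
Lemma tm_relE T i : tm_rel T i = 'X_i ^+ 2 - \sum_j T i j *: ('X_j * 'X_i).
Proof.
rewrite /tm_rel; congr (_ - _); rewrite [RHS](bigID (fun j : 'I_n => (j < i)%N)) /=.
rewrite [X in _ = _ + X]big1 ?addr0 // => j; rewrite -leqNgt => /TM_upper0->.
by rewrite scale0r.
Qed.

Lemma tm_alg_map T U (phi : {lrmorphism {mpoly F[n]} -> {mpoly F[n]}}) :
    (forall i, phi (tm_rel T i) \in tm_ideal U) ->
  exists f : {lrmorphism tm_alg T -> tm_alg U},
    forall p, f (tm_pi T p) = tm_pi U (phi p).
Proof.
move=> phiI; pose f (x : tm_alg T) : tm_alg U := tm_pi U (phi (repr x)).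
have fE p : f (tm_pi T p) = tm_pi U (phi p).
  have := tm_pi_eq (reprK (tm_pi T p)); case/asboolP=> q Dq; apply/eqP.
  rewrite -subr_eq0 -rmorphB -rmorphB /= Dq; apply/eqP/tm_pi_eq0.
  rewrite rmorph_sum /=; apply: rpred_sum => i _.
  by rewrite rmorphM; apply: idealMr; apply: phiI.
have piP (x : tm_alg T) : exists p, x = tm_pi T p.
  by exists (repr x); rewrite /tm_pi reprK.
have fB : zmod_morphism f.
  move=> x y; have [p ->] := piP x; have [q ->] := piP y.
  by rewrite -rmorphB !fE !rmorphB.
have fM : monoid_morphism f.
  split=> [|x y]; first by rewrite -(rmorph1 (tm_pi T)) fE !rmorph1.
  by have [p ->] := piP x; have [q ->] := piP y; rewrite -rmorphM !fE !rmorphM.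
have fZ : scalable f.
  by move=> c x; have [p ->] := piP x; rewrite -tm_piZ !fE linearZ tm_piZ.
pose fA := GRing.isZmodMorphism.Build _ _ f fB.
pose fMon := GRing.isMonoidMorphism.Build _ _ f fM.
pose fSc := GRing.isScalable.Build _ _ _ _ f fZ.
pose fL : {lrmorphism tm_alg T -> tm_alg U} := HB.pack f fA fMon fSc.
by exists fL.
Qed.

Local Notation mono_sub s e := (comp_mpoly [tuple e i *: 'X_(s i) | i < n]).

Lemma mono_subXU s e i : mono_sub s e 'X_i = e i *: 'X_(s i).
Proof. by rewrite comp_mpolyXU -tnth_nth tnth_mktuple. Qed.

Lemma mono_subX s e m :
  mono_sub s e 'X_[m] = \prod_i (e i *: 'X_(s i)) ^+ m i.
Proof.
rewrite comp_mpolyX; apply: eq_bigr => i _.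
by rewrite tnth_mktuple.
Qed.

Lemma mono_subE s e p :
  mono_sub s e p = \sum_(m <- msupp p) p@_m *: mono_sub s e 'X_[m].
Proof. exact: comp_mpolyEX. Qed.

Lemma mono_subK s e s' e' : (forall i, s' (s i) = i) ->
  (forall i, e i * e' (s i) = 1) -> cancel (mono_sub s e) (mono_sub s' e').
Proof.
move=> ss' ee' p; rewrite (mono_subE s) linear_sum [RHS]mpolyE.
apply: eq_bigr => m _; rewrite linearZ /= mono_subX rmorph_prod [in RHS]mpolyXE_id.
congr (_ *: _); apply: eq_bigr => i _.
by rewrite rmorphXn /= linearZ /= mono_subXU scalerA ee' ss' scale1r.
Qed.

Lemma mono_sub_homog s e p d : (forall m, m \in msupp p -> mdeg m = d) ->
  forall m, m \in msupp (mono_sub s e p) -> mdeg m = d.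
Proof.
move=> pd; apply/dhomogP; rewrite mono_subE big_seq rpred_sum // => m /pd <-.
apply: dhomogZ; rewrite mono_subX mdegE.
elim/big_rec2: _ => [|i k q _ qk]; first exact: dhomog1.
apply: dhomogM => //; rewrite -[X in X.-homog]mul1n.
by apply: dhomogMn; apply: dhomogZ; rewrite dhomogX /= mdeg1.
Qed.

Lemma mono_sub_rel s e T U i :
  (forall j, U i j * e j = e i * T (s i) (s j)) ->
  mono_sub s e (tm_rel U i) = e i ^+ 2 *: tm_rel T (s i).
Proof.
move=> UT; rewrite !tm_relE rmorphB rmorphXn /= mono_subXU scalerBr exprZn.
congr (_ - _); rewrite rmorph_sum scaler_sumr [RHS](reindex_inj (@perm_inj _ s)).
apply: eq_bigr => j _; rewrite /= comp_mpolyZ rmorphM /= !mono_subXU.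
by rewrite -scalerAl -scalerAr !scalerA UT expr2; congr (_ *: _); ring.
Qed.

(** The substitution of [(d i)^-1 X_(s i)] for [X_i] sends each relation of [U] to a multiple of one
    of [T], and the inverse substitution does the same in the other direction. *)
Lemma tm_sim_monomial s d T U : (forall i, d i != 0) ->
  (forall r k, U r k = (d r)^-1 * T (s r) (s k) * d k) -> tm_sim U T.
Proof.
move=> d0 UT; pose e i := (d i)^-1; pose e' i := d (s^-1%g i).
have [f fE] : exists f : {lrmorphism tm_alg U -> tm_alg T},
    forall p, f (tm_pi U p) = tm_pi T (mono_sub s e p).
  apply: tm_alg_map => i; rewrite /= (@mono_sub_rel s e T) => [|j].
    by rewrite -mul_mpolyC idealMr ?tm_rel_mem.
  by rewrite UT /e mulfK.
have [g gE] : exists g : {lrmorphism tm_alg T -> tm_alg U},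
    forall p, g (tm_pi T p) = tm_pi U (mono_sub (s^-1%g) e' p).
  apply: tm_alg_map => i; rewrite /= (@mono_sub_rel (s^-1)%g e' U) => [|j].
    by rewrite -mul_mpolyC idealMr ?tm_rel_mem.
  by rewrite UT /e' !permKV !mulrA mulfV ?mul1r.
exists f.
  exists g => x; rewrite -[x]reprK.
    rewrite [f _]fE [g _]gE mono_subK // => i; first by rewrite permK.
    by rewrite /e /e' permK mulVf.
  rewrite [g _]gE [f _]fE mono_subK // => i; first by rewrite permKV.
  by rewrite /e /e' mulfV.
move=> k _ [p -> pk]; exists (mono_sub s e p); first exact: fE.
(* The zero polynomial is homogeneous of every degree, odd ones included; only a nonempty support
   shows that [k] is twice a monomial degree. *)
have [msupp0|] := eqVneq (msupp p) [::].
  move/eqP: msupp0; rewrite msupp_eq0 => /eqP->; rewrite rmorph0 => m.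
  by rewrite msupp0.
case Dp: (msupp p) => [//|m0 r] _ m mp; rewrite -(pk m0) ?Dp ?mem_head //.
congr (2 * _)%N; apply: mono_sub_homog mp => m' /pk.
rewrite -(pk m0) ?Dp ?mem_head // => e2.
by apply/eqP; rewrite -(eqn_pmul2l (ltn0Sn 1)) e2.
Qed.

End MonomialIsomorphism.

(** * Reduction to the first echelon form by lexicographic descent *)

Section FirstReducedForm.
Variables (F : fieldType) (n : nat).
Implicit Types (T S : TM F n) (A : 'M[F]_n) (i j k r s : 'I_n).

Lemma TM_intro A : (forall i j, (i <= j)%N -> A i j = 0) ->
  exists S, tm_val S = A.
Proof.
move=> A0; have low : strictly_lower A; last by exists (MkTM low).
by apply/forallP=> i; apply/forallP=> j; apply/implyP=> /A0->.
Qed.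

Lemma lead_leP T r m :
  (lead T r <= m)%N <-> forall k, T r k != 0 -> (k < m)%N.
Proof. by split=> [/bigmax_leqP|H]; [|apply/bigmax_leqP]. Qed.

Lemma eq_lead T S r : (forall k, (T r k != 0) = (S r k != 0)) -> lead T r = lead S r.
Proof. by move=> TS; apply: eq_bigl => k; rewrite TS. Qed.

Lemma etoFE r s A i j : etoF r s A i j = A (tperm r s i) (tperm r s j).
Proof. by rewrite !mxE. Qed.

Lemma etoF_dom_TM r s T : etoF_dom r s T -> exists S, tm_val S = etoF r s T.
Proof.
case=> rs rowz colz; apply: TM_intro => i j; apply: contraTeq.
rewrite etoFE -ltnNge => Tij; have lt := TM_lt Tij; move: Tij lt.
case: (tpermP r s i) => [->|->|/eqP ir /eqP si].
- move=> Tsj _; have {Tsj}: (tperm r s j < r)%N.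
    by rewrite ltnNge; apply: contraNN Tsj => /rowz ->.
  by case: tpermP => [->|->|//]; rewrite ?ltnn // ltnNge (ltnW rs).
- move=> _; case: tpermP => [->|->|_ _]; rewrite ?ltnn //.
  by move/ltn_trans; apply.
case: tpermP => [->|->|_ _ //] Tir lti; first exact: ltn_trans lti.
rewrite ltnNge; apply: contraNN Tir => lesi; rewrite colz //.
by rewrite (ltnW lti).
Qed.

Definition lex_descent T S : Prop :=
  exists2 r : 'I_n, forall i : 'I_n, (i < r)%N -> lead S i = lead T i
    & (lead S r < lead T r)%N.

(** The type is finite, so the number of lexicographically smaller tuples is a measure for
    induction. *)
Definition lead_tuple T : n.-tuplelexi 'I_n.+1 := [tuple inord (lead T i) | i < n].

Lemma lex_descent_lt T S : lex_descent T S -> (lead_tuple S < lead_tuple T)%O.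
Proof.
case=> r eq_lt ltr; apply/ltxi_tuplePlt; exists r => [i /eq_lt e|].
  by rewrite !tnth_mktuple e.
have ltn1 U i : (lead U i < n.+1)%N.
  by rewrite ltnS (leq_trans (lead_le U i)) // ltnW.
by rewrite !tnth_mktuple Order.OrdinalOrder.ltEord !inordK.
Qed.

Lemma lex_descent_ind (P : TM F n -> Prop) :
  (forall T, (forall S, lex_descent T S -> P S) -> P T) -> forall T, P T.
Proof.
move=> IH T; have [m] := ubnP #|[set y | (y < lead_tuple T)%O]|.
elim: m T => // m IHm T leT; apply: IH => S /lex_descent_lt ltST.
apply: IHm; move: leT; rewrite ltnS; apply: leq_trans; apply: proper_card.
apply/properP; split.
  by apply/subsetP=> y; rewrite !inE => /Order.POrderTheory.lt_trans; apply.
by exists (lead_tuple S); rewrite !inE ?Order.POrderTheory.ltxx.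
Qed.

(** With [b = T r c / 2], vanishing of [Delta2 T i c r] is the domain condition of Q, and
    [T r c - 2 * b = 0] erases the leader. Otherwise only rows below [r] change. *)
Lemma etoQ_descent T r c : 2%:R != 0 :> F -> leader_pos T r c ->
    (forall i, (i < c)%N -> Delta2 T i c r = 0) ->
  exists2 S, eto T S & lex_descent T S.
Proof.
move=> n2 lrc D0; have [Trc cmax] := (leader_posP T r c).1 lrc.
have ltcr := TM_lt Trc; pose b := T r c / 2%:R.
have b2 : 2%:R * b = T r c by rewrite /b mulrC divfK.
have [|S SE] := @TM_intro (etoQ r c b T).
  move=> i j leij; rewrite mxE; case: andP => [[/eqP ei /eqP ej]|_].
    by move: leij; rewrite ei ej leqNgt ltcr.
  case: andP => [[/eqP ej ltri]|_]; last exact: TM_upper0.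
  by move: leij; rewrite ej leqNgt (ltn_trans ltcr).
exists S.
  apply: (@EtoQ _ _ _ _ r c b) => //; first by rewrite mulf_neq0 ?invr_neq0.
  split=> //; have [c0|c_gt0] := posnP c; [by left|right; split=> // i /D0].
  rewrite /Delta2 -b2 => D; apply/(mulfI n2)/eqP.
  by rewrite -subr_eq0 -{}[X in _ == X]D; apply/eqP; ring.
exists r => [i ltir|].
  apply: eq_lead => k; rewrite SE mxE.
  rewrite (_ : i == r = false) /=; last by apply/eqP=> e; rewrite e ltnn in ltir.
  by rewrite ltnNge (ltnW ltir) andbF.
rewrite lrc ltnS; apply/lead_leP => k; rewrite SE mxE eqxx /=.
have [->|nkc] := eqVneq k c; first by rewrite b2 subrr eqxx.
by move=> /cmax; rewrite leq_eqVlt (inj_eq val_inj) (negbTE nkc).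
Qed.

(** Row [s] ends before column [r], because [lead T s < lead T r <= r]; this gives the domain of F.
    Rows above [r] vanish in columns [r] and [s], so they are unaffected. *)
Lemma etoF_descent T r s : s = r.+1 :> nat -> (lead T s < lead T r)%N ->
  exists2 S, eto T S & lex_descent T S.
Proof.
move=> sr ltl; have ltrs : (r < s)%N by rewrite sr.
have Ts k : T s k != 0 -> (k < lead T s)%N by apply: lead_geS.
have ltsr : (lead T s < r)%N := leq_trans ltl (lead_le T r).
have dom : etoF_dom r s T.
  split=> // [j lerj|i /andP[leri leis]].
    apply/eqP; apply: contraLR lerj => /Ts ltj.
    by rewrite -ltnNge (ltn_trans ltj).
  move: leis; rewrite leq_eqVlt sr ltnS => /orP[/eqP eis|leir]; last first.
    exact: TM_upper0.
  apply/eqP; apply: contraTT ltsr; rewrite (_ : i = s); last first.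
    by apply: val_inj; rewrite /= eis sr.
  by move/Ts; rewrite -leqNgt => /ltnW.
have [S SE] := etoF_dom_TM dom; exists S; first exact: EtoF SE.
exists r => [i ltir|].
  have ltis : (i < s)%N by rewrite sr ltnS ltnW.
  apply: eq_lead => k; rewrite SE etoFE tpermD.
  - have [Tir Tis] := (TM_upper0 T (ltnW ltir), TM_upper0 T (ltnW ltis)).
    by case: tpermP => [->|->|//]; rewrite Tir Tis eqxx.
  - by apply/eqP=> e; rewrite e ltnn in ltir.
  - by apply/eqP=> e; rewrite e ltnn in ltis.
apply: leq_ltn_trans ltl; apply/lead_leP => k; rewrite SE etoFE tpermL.
case: tpermP => [->|->|_ _ /Ts //] /Ts; first exact: ltn_trans.
by move/(ltn_trans ltsr); rewrite ltnn.
Qed.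

Lemma eto_reduce T : 2%:R != 0 :> F ->
  exists S, [/\ eto_equiv T S, leader_cond S
    & forall r s, (r <= s)%N -> (lead S r <= lead S s)%N].
Proof.
move=> n2; elim/lex_descent_ind: T => T IH.
have step : (exists2 S, eto T S & lex_descent T S) -> exists S, [/\ eto_equiv T S,
    leader_cond S & forall r s, (r <= s)%N -> (lead S r <= lead S s)%N].
  case=> S TS /IH[U [SU lcU monoU]]; exists U; split=> //.
  by apply: rst_trans SU; apply: rst_step.
have [lcT|] := EM (leader_cond T); last first.
  move/existsNP=> [r /existsNP[c /not_implyP[lrc ncond]]].
  apply: step; apply: etoQ_descent lrc _ => // i ltic; apply/eqP.
  (* A nonzero [Delta2 T i c r] with [i < c] would also give [0 < c], so a failure at [(r, c)] makes
     all of them vanish. *)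
  apply: contra_notT ncond => Di; split; last by exists i.
  exact: leq_ltn_trans ltic.
have [/existsP[r /existsP[s /andP[/eqP sr ltl]]]|] :=
    boolP [exists r : 'I_n, exists s : 'I_n,
      (s == r.+1 :> nat) && (lead T s < lead T r)%N].
  exact/step/(etoF_descent sr).
move/existsPn=> noex; exists T; split=> //; first exact: rst_refl.
have adj r s : s = r.+1 :> nat -> (lead T r <= lead T s)%N.
  move=> sr; have /existsPn/(_ s) := noex r.
  by rewrite sr eqxx /= -leqNgt.
move=> r s /subnKC; move: (s - r)%N => d; elim: d s => [|d IHd] s.
  by rewrite addn0 => /ord_inj->.
rewrite addnS => rds; have ltd : (r + d < n)%N by rewrite ltnW // rds.
by apply: leq_trans (IHd (Ordinal ltd) erefl) (adj _ _ _).
Qed.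

(** Zero rows have [lead] equal to 0, so monotonicity over all rows also places them on top. *)
Lemma mono_one_ref S : leader_cond S ->
  (forall r s, (r <= s)%N -> (lead S r <= lead S s)%N) -> one_ref S.
Proof.
move=> lcS mono; right; split=> // [r s|r s sr _ _]; last by rewrite mono // sr.
rewrite !zero_rowE => /eqP r0 s0; rewrite ltnNge; apply/negP=> /mono.
by rewrite r0 leqn0 (negbTE s0).
Qed.

End FirstReducedForm.

(** * Walls and the blocks of indices that they cut out *)

Section WallBlocks.
Variables (F : fieldType) (n : nat).
Implicit Types (S T : TM F n) (r s c : 'I_n) (w : seq nat).

(* The j with r_j <= r < r_(j+1) when w is a wall, see [count_le_path]. *)
Definition block w r : nat := count (fun x => x <= r.+1)%N w.

Lemma block_mono w r s : (r <= s)%N -> (block w r <= block w s)%N.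
Proof. by move=> rs; apply: sub_count => x /= /leq_trans; apply. Qed.

Lemma block_eq0 w r : (forall x, x \in w -> (r.+1 < x)%N) -> block w r = 0%N.
Proof.
move=> gtw; apply/eqP; rewrite -leqn0 leqNgt -has_count; apply/hasPn=> x /gtw.
by rewrite ltnNge.
Qed.

(** This turns interval conditions on wall bounds into equations on [block]. If the head of [w] is
    at most [t], both sides shift by one; otherwise every entry exceeds [t] and the count is 0. *)
Lemma count_le_path N t x w j : (x <= t < N)%N -> path ltn x w ->
  (j <= size w)%N ->
  (nth 0 (x :: rcons w N) j <= t < nth 0 (rcons w N) j)%N
    = (count (fun y => y <= t)%N w == j).
Proof.
elim: w x j => [|y w IH] x j /andP[xt tN] /=; first by case: j => //=; rewrite xt tN.
case/andP=> ltxy yw; have [leyt|ltty] := leqP y t.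
  case: j => [|j] lej /=; first by rewrite ltnNge leyt andbF.
  by rewrite IH ?leyt // add1n eqSS.
have gtw z : z \in w -> (y < z)%N by move/allP: (order_path_min ltn_trans yw); apply.
rewrite (@eq_in_count _ _ pred0) ?count_pred0 => [|z /gtw ltyz]; last first.
  by apply: negbTE; rewrite -ltnNge (ltn_trans ltty).
case: j => [|j] lej /=; first by rewrite xt ltty.
rewrite leqNgt (_ : (t < _)%N = true) //.
have : nth 0%N (y :: rcons w N) j \in y :: rcons w N.
  by rewrite mem_nth //= size_rcons ltnS ltnW.
by rewrite inE mem_rcons inE => /or3P[/eqP->|/eqP->|/gtw] //; apply: ltn_trans.
Qed.

Lemma wall_exists S r : exists w, wall_from S r w.
Proof.
have [m] := ubnP (n - r); elim: m r => // m IH r.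
have [next0 _|[s0 s0n] lem] := set_0Vmem (wall_next S r).
  by exists [:: r.+1]; apply: WallStop.
case: (arg_minnP (fun s : 'I_n => s : nat) s0n) => s sn smin.
have {}sn : s \in wall_next S r := sn.
have ltrs : (r < s)%N by move: sn; rewrite inE => /andP[].
have [|w sw] := IH s; first by rewrite -ltnS (leq_trans _ lem) // ltnS ltn_sub2l.
by exists (r.+1 :: w); apply: WallStep sw.
Qed.

(** Rows from [r] up to the next wall entry have their leader column before [r], by minimality of
    that entry, hence in block 0. From the next entry on, monotonicity puts the leader columns at or
    after [r], so prepending [r.+1] raises both block numbers by one. *)
Lemma wall_fromP S r w : (forall s t : 'I_n, (s <= t)%N -> (lead S s <= lead S t)%N) ->
    wall_from S r w -> (0 < lead S r)%N ->
  [/\ nth 0%N w 0 = r.+1, path ltn r w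
    & forall s, (r <= s)%N -> exists2 c, leader_pos S s c & block w s = (block w c).+1].
Proof.
move=> mono wr; elim: {r w}wr => [r next0|r s w [sn smin] sw IH] lr0.
  split=> //= [|s lers]; first by rewrite ltnSn.
  have [|c Ssc lsc] := @lead_gt0 _ _ S s; first exact: leq_trans (mono _ _ lers).
  exists c => //; rewrite /block /= !addn0 ltnS lers.
  suff ltcr : (c < r)%N by rewrite leqNgt ltnS ltcr.
  move: lers; rewrite leq_eqVlt => /orP[/eqP/ord_inj->|ltrs].
    exact: TM_lt Ssc.
  by move/setP/(_ s): next0; rewrite !inE ltrs lsc ltnS leqNgt => /negbFE.
move: (sn); rewrite inE => /andP[ltrs lers].
have [|hd pw blk] := IH; first exact: leq_trans lers.
have gtw x : x \in w -> (s < x)%N by move/allP: (order_path_min ltn_trans pw); apply.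
have path_w : path ltn r.+1 w.
  case: (w) hd pw => //= y v -> /andP[_ ->]; rewrite andbT.
  by rewrite ltnS.
split=> //= [|t lert]; first by rewrite ltnSn.
have [lest|ltts] := leqP s t.
  have [c ltc Dt] := blk t lest; exists c => //.
  rewrite /block /= ltnS lert -!/(block _ _) Dt ltnS.
  by have := leq_trans lers (mono _ _ lest); rewrite ltc ltnS => ->.
have [|c Stc ltc] := @lead_gt0 _ _ S t; first exact: leq_trans (mono _ _ lert).
exists c => //.
have ltcr : (c < r)%N.
  move: lert; rewrite leq_eqVlt => /orP[/eqP/ord_inj->|ltrt]; first exact: TM_lt Stc.
  rewrite ltnNge; apply/negP=> lerc; move: ltts; rewrite ltnNge smin //.
  by rewrite inE ltrt ltc ltnS.
rewrite /block /= ltnS lert ltnS leqNgt ltcr -!/(block _ _).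
by rewrite !block_eq0 // => x /gtw; apply: leq_trans; rewrite ltnS // (ltn_trans ltcr).
Qed.

End WallBlocks.

(** * Permutations of the indices that preserve the blocks *)

Section BlockRearrangement.
Variables (F : fieldType) (n : nat) (b : 'I_n -> nat).
Hypothesis b_mono : forall r s : 'I_n, (r <= s)%N -> (b r <= b s)%N.
Implicit Types (S T U : TM F n) (i j k r s c : 'I_n) (d : 'I_n -> F)
  (p : {perm 'I_n}).

Lemma b_lt r s : (b r < b s)%N -> (r < s)%N.
Proof. by rewrite ltnNge; apply: contraNltn => /b_mono. Qed.

(** The second clause asks for some entry rather than the leader: this survives permutations within
    blocks, and with [b] monotone it still locates the leader. *)
Definition blocked T : Prop :=
  (forall r k, T r k != 0 -> (b k < b r)%N) /\
  (forall r, (0 < b r)%N -> exists2 c, T r c != 0 & b r = (b c).+1).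

Definition block_weight T r : nat := #|[set k | (b r == (b k).+1) && (T r k != 0)]|.

Lemma blocked_conj S T p : blocked S -> (forall i, b (p i) = b i) ->
  (forall r k, (T r k != 0) = (S (p r) (p k) != 0)) -> blocked T.
Proof.
move=> [ltS ledS] bp TS; split=> [r k|r]; first by rewrite TS => /ltS; rewrite !bp.
rewrite -bp => /ledS[c Src brc]; exists (p^-1%g c); first by rewrite TS permKV.
by rewrite brc -(bp (p^-1%g c)) permKV.
Qed.

Lemma block_weight_conj S T p r : (forall i, b (p i) = b i) ->
  (forall k, (T r k != 0) = (S (p r) (p k) != 0)) ->
  block_weight T r = block_weight S (p r).
Proof.
move=> bp TS; rewrite /block_weight -[RHS](card_preimset _ (@perm_inj _ p)).
by apply: eq_card => k; rewrite !inE TS !bp.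
Qed.

Lemma blocked_zero_row T r : blocked T -> zero_row T r = (b r == 0%N).
Proof.
move=> [ltT ledT]; rewrite zero_rowE.
have [b0|b0] := posnP (b r).
  by apply/eqP/lead_eq0 => k; apply/eqP; apply: contraT => /ltT; rewrite b0.
have [c Trc _] := ledT r b0.
by apply/negbTE; rewrite -lt0n (leq_trans _ (lead_geS Trc)).
Qed.

Lemma blocked_leader T r c : blocked T -> leader_pos T r c -> b r = (b c).+1.
Proof.
move=> [ltT ledT] /leader_posP[Trc cmax]; have ltcr := ltT _ _ Trc.
have [k Trk brk] := ledT r (leq_ltn_trans (leq0n _) ltcr).
apply/eqP; rewrite eqn_leq ltcr andbT brk ltnS.
exact/b_mono/cmax.
Qed.

(** By monotonicity all indices from [r] to [s] share one block, where [T] has no entries; this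
    gives the domain of F. *)
Lemma block_swap T r s : blocked T -> (r < s)%N -> b r = b s ->
  exists2 S, eto T S & forall i j, S i j = T (tperm r s i) (tperm r s j).
Proof.
move=> [ltT _] ltrs brs; have dom : etoF_dom r s T.
  split=> // [j|i /andP[leri leis]].
    move=> lerj; apply/eqP; apply: contraT => /ltT; rewrite -brs ltnNge.
    by rewrite b_mono.
  apply/eqP; apply: contraT => /ltT; rewrite ltnNge brs.
  by rewrite b_mono.
have [S SE] := etoF_dom_TM dom; exists S; first exact: EtoF SE.
by move=> i j; rewrite SE etoFE.
Qed.

(** Bubble sort: swapping an adjacent inversion moves the heavier row to the smaller coefficient
    [n - i], so the weighted sum drops. *)
Lemma block_sort T : blocked T -> exists S p, [/\ eto_equiv T S,
  forall i, b (p i) = b i, forall i j, S i j = T (p i) (p j)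
  & forall r s, s = r.+1 :> nat -> b r = b s ->
      (block_weight S r <= block_weight S s)%N].
Proof.
have [m] := ubnP (\sum_(i < n) (n - i) * block_weight T i).
elim: m T => // m IH T ltm blT.
have [/existsP[r /existsP[s /and3P[/eqP sr /eqP brs ltw]]]|noex] :=
  boolP [exists r : 'I_n, exists s : 'I_n, [&& s == r.+1 :> nat, b r == b s
    & (block_weight T s < block_weight T r)%N]]; last first.
  exists T, 1%g; split=> [|i|i j|r s sr brs]; rewrite ?perm1 //; first exact: rst_refl.
  have /existsPn/(_ r)/existsPn/(_ s) := noex.
  by rewrite sr brs !eqxx /= -leqNgt.
have ltrs : (r < s)%N by rewrite sr.
have [S TS SE] := block_swap blT ltrs brs.
have bt i : b (tperm r s i) = b i by case: tpermP => // ->.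
have wt i : block_weight S i = block_weight T (tperm r s i).
  by apply: block_weight_conj => // k; rewrite SE.
have [||V [p [SV bp VE sorted]]] := IH S.
- move: ltm; rewrite ltnS; apply: leq_trans.
  rewrite (bigD1 r) // (bigD1 s) 1?eq_sym ?neq_ltn ?ltrs //=.
  rewrite [leqRHS](bigD1 r) // [in leqRHS](bigD1 s) 1?eq_sym ?neq_ltn ?ltrs //=.
  rewrite !wt tpermL tpermR.
  rewrite (eq_bigr (fun i : 'I_n => (n - i) * block_weight T i))%N; last first.
    by move=> i /andP[ir si]; rewrite wt tpermD // eq_sym.
  rewrite !addnA -addSn leq_add2r sr; have := ltn_ord s; rewrite sr => ltn.
  by rewrite -(subnSK (ltnW ltn)) !mulSn -!addnA (addnC (_ * block_weight T s))%N ltn_add2r.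
- by apply: blocked_conj blT bt _ => i k; rewrite SE.
exists V, (p * tperm r s)%g; split=> // [|i|i j].
- by apply: rst_trans SV; apply: rst_step.
- by rewrite permM bt bp.
by rewrite VE SE !permM.
Qed.

(** Permuting a block may change which entry leads a row. If two entries of row [r] lie in the
    leader's block, the smaller column is a witness; otherwise the leader comes from the leader of
    [S], whose witness is transported. *)
Lemma blocked_leader_cond S T p d : 2%:R != 0 :> F -> blocked S -> leader_cond S ->
  (forall i, b (p i) = b i) -> (forall i, d i != 0) ->
  (forall r k, T r k = (d r)^-1 * S (p r) (p k) * d k) -> leader_cond T.
Proof.
move=> n2 blS lcS bp d0 TE r c lrc.
have nzE i k : (T i k != 0) = (S (p i) (p k) != 0).
  by rewrite TE !mulf_eq0 invr_eq0 (negbTE (d0 i)) (negbTE (d0 k)) orbF.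
have blT : blocked T := blocked_conj blS bp nzE.
have [Trc cmax] := (leader_posP T r c).1 lrc.
have brc := blocked_leader blT lrc.
suff [i ltic Di] : exists2 i : 'I_n, (i < c)%N & Delta2 T i c r != 0.
  by split; [exact: leq_ltn_trans ltic | exists i].
have [/existsP[k /and3P[nekc Trk /eqP bkc]]|uniq] :=
  boolP [exists k, [&& k != c, T r k != 0 & b k == b c]].
  (* Here [T c k = 0] within a block, so the discriminant is [2 * T r k]. *)
  exists k; first by rewrite ltn_neqAle cmax ?andbT.
  rewrite /Delta2 (_ : T c k = 0) ?mulr0 ?addr0 ?mulf_neq0 //.
  by apply/eqP; apply: contraT => /(blT.1); rewrite bkc ltnn.
have {}uniq k : T r k != 0 -> b k = b c -> k = c.
  move=> Trk bkc; have /existsPn/(_ k) := uniq.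
  by rewrite Trk bkc eqxx !andbT => /negbNE/eqP.
have lpSc : leader_pos S (p r) (p c).
  have [|c0 Src0 lc0] := @lead_gt0 _ _ S (p r).
    by apply: leq_trans (lead_geS (_ : S (p r) (p c) != 0)); rewrite -?nzE.
  rewrite /leader_pos lc0; congr (nat_of_ord _).+1.
  have := blocked_leader blS lc0; rewrite bp brc => -[bc0].
  rewrite -(uniq (p^-1%g c0)) ?permKV //; first by rewrite nzE permKV.
  by rewrite -(bp (p^-1%g c0)) permKV.
have [_ [i0 lti0 D0]] := lcS _ _ lpSc; exists (p^-1%g i0); last first.
  have -> : Delta2 T (p^-1%g i0) c r =
      (d r)^-1 * d (p^-1%g i0) * Delta2 S i0 (p c) (p r).
    rewrite /Delta2 !TE permKV.
    transitivity ((d r)^-1 * d (p^-1%g i0) *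
      (2%:R * S (p r) i0 + (d c * (d c)^-1) * (S (p r) (p c) * S (p c) i0))).
      by ring.
    by rewrite mulfV // mul1r.
  by rewrite !mulf_neq0 ?invr_neq0.
(* The witness [i0] lies in a strictly earlier block than [p c], so it stays before [c]: in the same
   block both terms of its discriminant would vanish. *)
apply: b_lt; rewrite -bp permKV ltn_neqAle -(bp c) b_mono ?(ltnW lti0) // andbT.
apply: contraNneq D0 => bi; rewrite /Delta2.
have -> : S (p c) i0 = 0.
  by apply/eqP; apply: contraT => /(blS.1); rewrite bi ltnn.
suff -> : S (p r) i0 = 0 by rewrite !mulr0 addr0.
apply/eqP; apply: contraT => Sri.
have ec : p^-1%g i0 = c.
  by apply: uniq; rewrite ?nzE ?permKV // -(bp (p^-1%g i0)) permKV bi bp.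
by move: lti0; rewrite -ec permKV ltnn.
Qed.

End BlockRearrangement.

(** * Diagonal conjugation by means of P *)

Section DiagonalRescaling.
Variables (F : fieldType) (n : nat).
Implicit Types (S T : TM F n) (i j k r c : 'I_n) (d : 'I_n -> F).

Lemma eto_diag T d : (forall i, d i != 0) ->
  exists2 S, eto_equiv T S & forall i j, S i j = (d i)^-1 * T i j * d j.
Proof.
move=> d0; pose dl (l : seq 'I_n) i := if i \in l then d i else 1.
suff [S TS SE] : exists2 S, eto_equiv T S &
    forall i j, S i j = (dl (enum 'I_n) i)^-1 * T i j * dl (enum 'I_n) j.
  by exists S => // i j; rewrite SE /dl !mem_enum.
elim: (enum 'I_n) (enum_uniq 'I_n) => [_|a l IH /= /andP[al ul]].
  by exists T => [|i j]; [exact: rst_refl | rewrite /dl !in_nil invr1 mul1r mulr1].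
have [S TS SE] := IH ul.
have [|V VE] := @TM_intro _ _ (etoP a (d a) S).
  by move=> i j leij; rewrite mxE (TM_upper0 S leij) !mulr0 !if_same.
exists V; first by apply: rst_trans TS _; apply: rst_step; apply: EtoP VE.
move=> i j; rewrite VE mxE !SE /dl !inE.
(* At [i = j = a] the operation only divides, while conjugation also multiplies; the diagonal entry
   is 0 anyway. *)
have [->|_] := eqVneq i a; have [->|_] := eqVneq j a;
  rewrite /= ?(negbTE al) ?invr1.
- by rewrite (TM_upper0 T (leqnn a)) !(mulr0, mul0r).
- by rewrite mul1r mulrA.
- by rewrite mulr1 mulrC.
by [].
Qed.

(** The equation [d r = T r c * d c] makes the leader 1 after conjugation. Since [c < r], it is
    solved from the top row downwards, with free values [f] on zero rows. *)
Lemma diag_exists T (f : 'I_n -> F) : (forall i, f i != 0) ->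
  exists d, [/\ forall i, d i != 0, forall r, zero_row T r -> d r = f r
    & forall r c, leader_pos T r c -> d r = T r c * d c].
Proof.
move=> f0.
suff /(_ n)[d [d0 dz dl]] : forall m, exists d, [/\ forall i, d i != 0,
    forall r, (r < m)%N -> zero_row T r -> d r = f r
    & forall r c, (r < m)%N -> leader_pos T r c -> d r = T r c * d c].
  by exists d; split=> // [r|r c]; [exact: dz | exact: dl].
elim=> [|m [d [d0 dz dl]]]; first by exists f.
have [ltmn|lenm] := ltnP m n; last first.
  by exists d; split=> // [r|r c] _; [apply: dz | apply: dl]; apply: leq_trans lenm.
pose rm := Ordinal ltmn.
have [v [v0 vz vl]] : exists v, [/\ v != 0, zero_row T rm -> v = f rm
    & forall c, leader_pos T rm c -> v = T rm c * d c].
  rewrite zero_rowE /leader_pos; have [->|/lead_gt0[c Trc ->]] := posnP (lead T rm).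
    by exists (f rm); split.
  exists (T rm c * d c); split; rewrite ?mulf_neq0 //.
  by move=> k /succn_inj/ord_inj->.
exists (fun i => if i == rm then v else d i); split=> [i|r|r c].
- by case: ifP => _.
- rewrite ltnS leq_eqVlt => /orP[/eqP er|ltrm].
    by rewrite (_ : r = rm) ?eqxx //; apply: val_inj.
  by rewrite -val_eqE /= (ltn_eqF ltrm); apply: dz.
move=> lerm lrc; have ltcr : (c < r)%N by case/leader_posP: lrc => /TM_lt.
have ltcm : (c < m)%N by apply: leq_trans ltcr _.
rewrite -[c == rm]val_eqE /= (ltn_eqF ltcm); move: lerm lrc.
rewrite ltnS leq_eqVlt => /orP[/eqP er|ltrm].
  by rewrite (_ : r = rm) ?eqxx; [apply: vl | apply: val_inj].
by rewrite -val_eqE /= (ltn_eqF ltrm); apply: dl.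
Qed.

End DiagonalRescaling.

(** * From blocks to the second echelon form *)

Section SecondReducedForm.
Variables (F : fieldType) (n : nat).
Implicit Types (S T U : TM F n) (r s t c k : 'I_n) (w : seq nat).

Lemma wall_blocks S : (forall s t : 'I_n, (s <= t)%N -> (lead S s <= lead S t)%N) ->
    S <> tm0 F n ->
  exists r w, [/\ is_min [set s | ~~ zero_row S s] r, wall_from S r w,
    blocked (block w) S, wall_bound n w 1 = r.+1
    & forall j s, (j <= size w)%N ->
        (wall_bound n w j <= s.+1 < wall_bound n w j.+1)%N = (block w s == j)].
Proof.
move=> mono nzS; have [r0 r0nz] : exists r, r \in [set s | ~~ zero_row S s].
  apply/existsP; apply: contra_notT nzS => /existsPn z; apply/TM0P => r.
  by apply/lead_eq0/eqP; have := z r; rewrite inE negbK zero_rowE.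
case: (arg_minnP (fun s : 'I_n => s : nat) r0nz) => r rnz0 rmin.
have {r0 r0nz}rnz : r \in [set s | ~~ zero_row S s] := rnz0.
have {}rmin s : s \in [set s | ~~ zero_row S s] -> (r <= s)%N := rmin s.
have lr0 : (0 < lead S r)%N by move: rnz; rewrite inE zero_rowE lt0n.
have r_gt0 : (0 < r)%N := leq_trans lr0 (lead_le S r).
have [w wr] := wall_exists S r; have [w0 pw blk] := wall_fromP mono wr lr0.
have gtw x : x \in w -> (r < x)%N by move/allP: (order_path_min ltn_trans pw); apply.
have size_w : (0 < size w)%N by case: (w) w0.
exists r, w; split=> //.
- split=> [s k Ssk|s bs].
    have lers : (r <= s)%N.
      apply: (rmin s); rewrite inE zero_rowE -lt0n.
      exact: leq_trans (lead_geS Ssk).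
    have [c /leader_posP[_ cmax] ->] := blk s lers.
    by rewrite ltnS block_mono // cmax.
  have lers : (r <= s)%N.
    rewrite leqNgt; apply: contraL bs => ltsr.
    by rewrite block_eq0 // => x /gtw; apply: leq_ltn_trans.
  have [c /leader_posP[Ssc _] bsc] := blk s lers.
  by exists c.
- by rewrite /wall_bound /= nth_rcons size_w.
(* The endpoints are the conventions [r_0 = 1] and [r_(h+1) = n + 1]; the path starts above 1
   because the first nonzero row has positive index. *)
move=> j s lej; rewrite /wall_bound /= count_le_path //.
  by rewrite /= ltnS ltn_ord.
case: (w) w0 pw => //= y v -> /andP[_ ->]; rewrite andbT.
by rewrite ltnS.
Qed.

Lemma blocked_two_ref U r w : blocked (block w) U -> leader_cond U ->
    wall_bound n w 1 = r.+1 ->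
    (forall j s, (j <= size w)%N ->
        (wall_bound n w j <= s.+1 < wall_bound n w j.+1)%N = (block w s == j)) ->
    (forall s t, t = s.+1 :> nat -> block w s = block w t ->
        (block_weight (block w) U s <= block_weight (block w) U t)%N) ->
  two_ref_wrt w U.
Proof.
move=> blU lcU w1 bw sorted; have zU := blocked_zero_row _ blU.
have bm := @block_mono n w.
split; first split.
- rewrite w1 -sum1_card (eq_bigl (fun s : 'I_n => (s < r)%N)) => [|s].
    by rewrite -(big_ord_widen n (fun=> 1%N)) ?sum_nat_const ?card_ord ?muln1 // ltnW.
  by rewrite inE zU // -bw // w1.
- move=> s t; rewrite !zU => /eqP bs bt; rewrite (b_lt bm) // bs lt0n.
  exact: bt.
- split=> // -[//|j] s jw; rewrite bw // => /eqP bs.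
  have [|c Usc _] := blU.2 s; first by rewrite bs.
  have [|k Usk lk] := @lead_gt0 _ _ U s; first exact: leq_trans (lead_geS Usc).
  have /eqP := blocked_leader bm blU lk.
  by rewrite bs lk eqSS eq_sym -bw // ltnW.
move=> [//|j] s t jw ts /andP[ljs ltj].
(* The predecessor in the bound leaves room for the next row [t] in the same block. *)
have ltsj : (s.+2 < wall_bound n w j.+2)%N by rewrite -ltn_predRL.
have bs : block w s = j.+1.
  by apply/eqP; rewrite -bw // ljs (ltn_trans _ ltsj).
have bt : block w t = j.+1.
  by apply/eqP; rewrite -bw // ts ltsj (leq_trans ljs).
have wE q : block w q = j.+1 -> row_weight U w j.+1 q = block_weight (block w) U q.
  by move=> bq; apply: eq_card => k; rewrite !inE bq eqSS [in RHS]eq_sym -bw // ltnW.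
by rewrite !wE // sorted // bs bt.
Qed.

End SecondReducedForm.

Theorem proposition2p2 (F : fieldType) (n : nat) (T : TM F n) :
  2 \notin [pchar F]%R -> (2 <= n)%N ->
  exists U : TM F n, normalized U /\ eto_equiv T U.
Proof.
rewrite inE /= => n2 _.
have [S [TS lcS mono]] := eto_reduce T n2.
have [S0|nzS] := EM (S = tm0 F n).
  by exists S; split=> //; left.
have [r [w [rmin wr blS w1 bw]]] := wall_blocks mono nzS.
have [V [p [SV bp VE sorted]]] := block_sort (block_mono w) blS.
have blV : blocked (block w) V by apply: blocked_conj blS bp _ => i j; rewrite VE.
(* Scaling the indices of zero rows by inverses of the entries of the first nonzero row [r] will
   turn those entries into 1; the default 1 keeps [f] nonzero. *)
pose f k := if V r k == 0 then 1 else (V r k)^-1.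
have [|d [d0 dz dl]] := @diag_exists F n V f.
  by move=> k; rewrite /f; case: ifPn => [_|]; rewrite ?oner_neq0 ?invr_eq0.
have [U VU UE] := eto_diag V d0.
have nzE i j : (U i j != 0) = (V i j != 0).
  by rewrite UE !mulf_eq0 invr_eq0 (negbTE (d0 i)) (negbTE (d0 j)) orbF.
have US i j : U i j = (d i)^-1 * S (p i) (p j) * d j by rewrite UE VE.
have lcU := blocked_leader_cond (block_mono w) n2 blS lcS bp d0 US.
have blU : blocked (block w) U.
  by apply: (blocked_conj (p := 1%g)) blV _ _ => [i|i j]; rewrite !perm1.
have lpE i j : leader_pos U i j -> leader_pos V i j.
  by rewrite /leader_pos (eq_lead (nzE i)).
have nsim : ~ tm_sim U (tm0 F n).
  move/(tm_sim0_eq0 n2 lcU)/TM0P => U0; apply: nzS; apply/TM0P=> i j.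
  have /eqP := U0 (p^-1%g i) (p^-1%g j).
  by rewrite US !permKV !mulf_eq0 invr_eq0 !(negbTE (d0 _)) orbF => /eqP.
have wallU : is_wall U w.
  exists S; split; [exact: mono_one_ref | exact: tm_sim_monomial US|right].
  by split; [move/(tm_sim0_eq0 n2 lcS) | exists r].
have two : two_ref_wrt w U.
  apply: (@blocked_two_ref _ _ _ r) => // s t ts bst.
  have wE x : block_weight (block w) U x = block_weight (block w) V x.
    by apply: eq_card => k; rewrite !inE nzE.
  by rewrite !wE sorted.
exists U; split; last by apply: rst_trans TS _; apply: rst_trans SV VU.
right; split=> //; first by right; split=> //; exists w.
exists w => //; split=> [s c|s c _ lsc].
  rewrite w1 => -[/ord_inj->]; rewrite nzE => Vrc.
  have zlt (k : 'I_n) : (k < r)%N -> d k = f k.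
    by move=> ltkr; apply: dz; rewrite (blocked_zero_row _ blV) -bw // w1.
  (* For the leader column [k] of row [r], [d r = V r k * f k = 1], so the entry at [c] becomes
     [V r c * f c = 1]. *)
  have [|k Vrk lk] := @lead_gt0 _ _ V r; first exact: leq_trans (lead_geS Vrc).
  rewrite UE (dl _ _ lk) !zlt ?(TM_lt Vrc) ?(TM_lt Vrk) // /f.
  by rewrite (negbTE Vrc) (negbTE Vrk) mulfV // invr1 mul1r mulfV.
have lVsc := lpE _ _ lsc; rewrite UE (dl _ _ lVsc) -mulrA mulVf //.
by have [Vsc _] := (leader_posP V s c).1 lVsc; rewrite mulf_neq0.
Qed.
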